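(* Let $F$ be a field, $D$ a quaternion algebra over $F$ with canonical involution $x\mapsto \bar x$, and $c\in D^\times\setminus F$. (a) Let $A=\mathrm{Cay}(D,c)$. Then $\mathrm{Nuc}_l(A)=\mathrm{Nuc}_m(A)=\mathrm{Nuc}_r(A)=F$, hence $\mathrm{Nuc}(A)=F$. Furthermore, $\mathrm{Comm}(A)=F$ and $\mathrm{C}(A)=F$. (b) Let $A=\mathrm{Cay}_m(D,c)$. Then $\mathrm{Nuc}_l(A)=\mathrm{Nuc}_m(A)=\mathrm{Nuc}_r(A)=F$, thus $\mathrm{Nuc}(A)=F$. If $D$ is a division algebra then $\mathrm{Comm}(A)=F$; otherwise $$\mathrm{Comm}(A)=\{(u,v)\mid u\in F \text{ and } v(\overline{u'}-u')=0,\ \overline{v'}cv=\bar v c v' \text{ for all } u',v'\in D\}$$ $$\subset\{(u,v)\mid u\in F,\ cv=\bar v c,\ N_{D/F}(v)=0\}.$$ Thus $\mathrm{C}(A)=F$ in any case. (c) Let $A=\mathrm{Cay}_r(D,c)$. Then $\mathrm{Nuc}_l(A)=\mathrm{Nuc}_m(A)=\mathrm{Nuc}_r(A)=F$, hence $\mathrm{Nuc}(A)=F$, and $\mathrm{Comm}(A)=F$ and $\mathrm{C}(A)=F$.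
   Context: For a nonassociative algebra $A$ put $[x,y,z]=(xy)z-x(yz)$, and let $\mathrm{Nuc}_l(A)=\{x\mid [x,A,A]=0\}$, $\mathrm{Nuc}_m(A)=\{x\mid [A,x,A]=0\}$, $\mathrm{Nuc}_r(A)=\{x\mid [A,A,x]=0\}$, $\mathrm{Nuc}(A)$ their intersection, $\mathrm{Comm}(A)=\{x\in A\mid xy=yx \text{ for all } y\in A\}$ and $\mathrm{C}(A)=\mathrm{Nuc}(A)\cap\mathrm{Comm}(A)$. $F$ is identified with $F1\subset A$, and $N_{D/F}(x)=x\bar x$. The $F$-vector space $D\oplus D$ becomes a unital $F$-algebra with unit $(1,0)$ under each of the following multiplications ($u,v,u',v'\in D$): $\mathrm{Cay}(D,c)$: $(u,v)(u',v')=(uu'+c\,\bar{v'}v,\ v'u+v\bar{u'})$; $\mathrm{Cay}_m(D,c)$: $(u,v)(u',v')=(uu'+\bar{v'}cv,\ v'u+v\bar{u'})$; $\mathrm{Cay}_r(D,c)$: $(u,v)(u',v')=(uu'+\bar{v'}v\,c,\ v'u+v\bar{u'})$. *)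

(* Defs.v *)
From HB Require Import structures.
From mathcomp Require Import all_boot all_order all_algebra all_field.
From mathcomp Require Import classical_sets.

Set Implicit Arguments.
Unset Strict Implicit.
Unset Printing Implicit Defensive.

Import GRing.Theory.
Local Open Scope ring_scope.
Local Open Scope classical_set_scope.

(* A nonassociative algebra is given by its underlying additive group V
   together with the multiplication mul. *)
Section Nonassociative.
Variables (V : zmodType) (mul : V -> V -> V).

Definition associator (x y z : V) : V := mul (mul x y) z - mul x (mul y z).

Definition Nuc_l : set V := [set x | forall y z, associator x y z = 0].
Definition Nuc_m : set V := [set x | forall y z, associator y x z = 0].
Definition Nuc_r : set V := [set x | forall y z, associator y z x = 0].
Definition Nuc : set V := Nuc_l `&` Nuc_m `&` Nuc_r.
Definition Comm : set V := [set x | forall y, mul x y = mul y x].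
Definition Center : set V := Nuc `&` Comm.

End Nonassociative.

Section Quaternion.
Variables (F : fieldType) (D : falgType F).

(* Central simple of dimension 4, in any characteristic.  Since D is finite
   dimensional over F, its two-sided ideals are the subspaces stable under
   left and right multiplication; 1%VS is F1 inside D. *)
Record quaternion_algebra : Prop := QuaternionAlgebra {
  quaternion_dim : \dim {:D} = 4%N;
  quaternion_central : ('Z({:D}) = 1)%VS;
  quaternion_simple : forall I : {vspace D},
    ({:D} * I <= I)%VS -> (I * {:D} <= I)%VS -> I = 0%VS \/ I = {:D}%VS
}.

Definition division_algebra : Prop :=
  forall x : D, x != 0 -> x \is a GRing.unit.

(* These properties determine bar: it fixes F1, and an x outside F1 is a root
   of 'X^2 - (x + bar x) 'X + x * bar x, hence of its minimal polynomial over
   F, so that x + bar x and x * bar x are the reduced trace and norm of x. *)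
Record canonical_involution (bar : D -> D) : Prop := CanonicalInvolution {
  bar_linear : linear bar;
  bar_antimul : forall x y, bar (x * y) = bar y * bar x;
  bar_involutive : involutive bar;
  bar_trace : forall x, x + bar x \in 1%VS;
  bar_norm : forall x, x * bar x \in 1%VS
}.

Variables (bar : D -> D) (c : D).

Definition qnorm (x : D) : D := x * bar x.

Definition Cay (x y : D * D) : D * D :=
  let: (u, v) := x in let: (u', v') := y in
  (u * u' + c * bar v' * v, v' * u + v * bar u').

Definition Cay_m (x y : D * D) : D * D :=
  let: (u, v) := x in let: (u', v') := y in
  (u * u' + bar v' * c * v, v' * u + v * bar u').

Definition Cay_r (x y : D * D) : D * D :=
  let: (u, v) := x in let: (u', v') := y in
  (u * u' + bar v' * v * c, v' * u + v * bar u').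

End Quaternion.

(* F identified with F1 in the doubled algebra, whose unit is (1, 0) and not
   the unit (1, 1) of the product ring D * D. *)
Definition scalars (F : fieldType) (D : falgType F) : set (D * D) :=
  range (fun a : F => a *: ((1, 0) : D * D)).
Arguments scalars {F} D.

(* Main.v *)
(* For each of the three multiplications, evaluating the defining identity of a
   nucleus or of Comm on elements with a vanishing component shows that the
   second component v of a member annihilates all commutators of D, or all
   differences bar u - u; the latter case reduces to the former.  As D is
   simple and, c being noncentral, noncommutative, this forces v = 0, and then
   the first component is central.  The product term involving c matters only
   through its homogeneity in both arguments, so the three cases are one. *)
Require Import Defs.
From HB Require Import structures.
From mathcomp Require Import all_boot all_order all_algebra all_field.
From mathcomp Require Import classical_sets.

Set Implicit Arguments.
Unset Strict Implicit.
Unset Printing Implicit Defensive.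

Import GRing.Theory.
Local Open Scope ring_scope.
Local Open Scope classical_set_scope.

Section QuaternionAlgebra.
Variables (F : fieldType) (D : falgType F).
Hypothesis D_quat : quaternion_algebra D.

Lemma quaternion_central_scalar (x : D) :
  (forall y, x * y = y * x) -> exists a : F, x = a%:A.
Proof.
move=> xC; apply/vlineP; rewrite -(quaternion_central D_quat).
by rewrite memv_cap memvf; apply/centvP => y _; rewrite xC.
Qed.

(** [D] is a prime ring: the two-sided ideal [I] generated by [x] is killed by [v] from the left,
    and by simplicity either [I = 0], so [x = 0], or [1] lies in [I], so [v = 0]. *)
Lemma quaternion_prime (v x : D) :
  (forall d, v * d * x = 0) -> v = 0 \/ x = 0.
Proof.
move=> vDx; pose I := ({:D} * <[x]> * {:D})%VS.
have xI : x \in I.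
  by rewrite -[x]mulr1 -[x]mul1r !memv_mul ?memvf ?memv_line.
have vI : (<[v]> * I <= 0)%VS.
  suff vDx0 : (<[v]> * {:D} * <[x]> <= 0)%VS.
    by rewrite !prodvA (subv_trans (prodvSl _ vDx0)) ?prod0v.
  apply/prodvP => y _ yvD /vlineP[b ->].
  (* As [y] is a sum of products, the claim is recast as inclusion in the kernel of right
     multiplication by [x], which can be tested on products. *)
  suff /subvP/(_ y yvD) : (<[v]> * {:D} <= lker (amulr x))%VS.
    by rewrite memv_ker lfunE /= -scalerAr => /eqP ->; rewrite scaler0 mem0v.
  apply/prodvP => _ d /vlineP[a ->] _.
  by rewrite memv_ker lfunE /= -!scalerAl vDx scaler0.
have [||I0|I1] := quaternion_simple D_quat (I := I).
- by rewrite /I !prodvA !prodvSl ?subvf.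
- by rewrite /I -prodvA prodvSr ?subvf.
- by right; apply/eqP; rewrite -memv0 -I0.
left; apply/eqP; rewrite -memv0 -[v]mulr1.
by rewrite (subvP vI) // I1 memv_mul ?memv_line ?memvf.
Qed.

Hypothesis D_noncomm : exists x y : D, x * y != y * x.

Lemma annihilator_commutators (v : D) :
  (forall x y, v * (x * y - y * x) = 0) -> v = 0.
Proof.
move=> vC; have [x [y]] := D_noncomm; rewrite -subr_eq0 => /eqP xyN0.
case: (@quaternion_prime v (x * y - y * x)) => // d.
(* The derivation rule [x, d y] = [x, d] y + d [x, y]. *)
have -> : v * d * (x * y - y * x) =
          v * (x * (d * y) - d * y * x) - v * (x * d - d * x) * y.
  by rewrite !(mulrBr, mulrBl, mulrA) opprB [RHS]addrC addrA subrK.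
by rewrite !vC mul0r subrr.
Qed.

Variable bar : D -> D.
Hypothesis bar_can : canonical_involution bar.

(** Left multiplication by [v] does not distinguish [u] from [bar u]. Applied to [bar y * x], whose
    conjugate is [bar x * y], this gives [v * x * y = v * y * x]. *)
Lemma annihilator_bar_sub (v : D) :
  (forall u, v * (bar u - u) = 0) -> v = 0.
Proof.
move=> vB; have vbar u : v * bar u = v * u.
  by apply/eqP; rewrite -subr_eq0 -mulrBr vB.
apply: annihilator_commutators => x y; apply/eqP; rewrite mulrBr subr_eq0.
have := vbar (bar y * x); rewrite (bar_antimul bar_can) (bar_involutive bar_can).
by rewrite !mulrA !vbar => <-.
Qed.

Lemma bar0 : bar 0 = 0.
Proof.
by have := bar_linear bar_can (-1) 0 0; rewrite !scaleN1r !addNr.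
Qed.

Lemma barZ (a : F) (x : D) : bar (a *: x) = a *: bar x.
Proof. by have := bar_linear bar_can a x 0; rewrite bar0 !addr0. Qed.

Lemma bar1 : bar 1 = 1.
Proof.
have := bar_antimul bar_can (bar 1) 1.
by rewrite mulr1 (bar_involutive bar_can) mulr1.
Qed.

Section Doubling.
Variable P : D -> D -> D.
Hypothesis P_scalel : forall (a : F) x y, P (a *: x) y = a *: P x y.
Hypothesis P_scaler : forall (a : F) x y, P x (a *: y) = a *: P x y.

(** [P v' v] stands for the term containing [c], with its arguments in the order in which [bar v']
    and [v] occur there. *)
Definition doubling (x y : D * D) : D * D :=
  let: (u, v) := x in let: (u', v') := y in
  (u * u' + P v' v, v' * u + v * bar u').

Let P0l y : P 0 y = 0. Proof. by have := P_scalel 0 0 y; rewrite !scale0r. Qed.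
Let P0r x : P x 0 = 0. Proof. by have := P_scaler 0 x 0; rewrite !scale0r. Qed.

Lemma doubling_scalel (a : F) x y : doubling (a *: x) y = a *: doubling x y.
Proof.
case: x y => [u v] [u' v']; congr pair => /=.
  by rewrite -scalerAl P_scaler scalerDr.
by rewrite -scalerAl -scalerAr scalerDr.
Qed.

Lemma doubling_scaler (a : F) x y : doubling x (a *: y) = a *: doubling x y.
Proof.
case: x y => [u v] [u' v']; congr pair => /=.
  by rewrite -scalerAr P_scalel scalerDr.
by rewrite barZ -scalerAl -scalerAr scalerDr.
Qed.

Lemma doubling_1x x : doubling (1, 0) x = x.
Proof. by case: x => u v /=; rewrite P0r mul1r mulr1 mul0r !addr0. Qed.

Lemma doubling_x1 x : doubling x (1, 0) = x.
Proof. by case: x => u v /=; rewrite P0l bar1 !mulr1 mul0r addr0 add0r. Qed.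

(** These rules pull scalars out and delete the unit, so both bracketings of a product with a factor
    [a *: (1, 0)] agree; this puts F inside every nucleus and inside [Comm]. *)
Let unitalE := (doubling_scalel, doubling_scaler, doubling_1x, doubling_x1).

Lemma scalars_of_components (u v : D) :
  v = 0 -> (forall w, u * w = w * u) -> scalars D (u, v).
Proof.
move=> -> /quaternion_central_scalar[a ->].
by exists a => //; congr pair; rewrite /= ?scaler0.
Qed.

Let zeroE := (P0l, P0r, mul0r, addr0, add0r).

Lemma Nuc_l_doubling : Nuc_l doubling = scalars D.
Proof.
apply/seteqP; split=> [[u v] uvN|_ [a _ <-] y z]; last first.
  by rewrite /associator !unitalE subrr.
have v0 : v = 0.
  apply: annihilator_commutators => x y.
  (* Right multiplication by [(w, 0)] multiplies second components by [bar w]; the bars in the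
     arguments compensate for this. *)
  have := congr1 snd (uvN (bar x, 0) (bar y, 0)); rewrite /associator /= !zeroE.
  by rewrite ?(bar_antimul bar_can) ?(bar_involutive bar_can) -!mulrA mulrBr.
apply: scalars_of_components => // w.
(* Left multiplication by [(u, 0)] is right multiplication by [u] on second components, hence
   reverses products: the two bracketings give [u * w] and [w * u]. *)
have := congr1 snd (uvN (w, 0) (0, 1)); rewrite /associator v0 /= !zeroE.
by rewrite !mul1r => /eqP; rewrite subr_eq0 => /eqP.
Qed.

Lemma Nuc_m_doubling : Nuc_m doubling = scalars D.
Proof.
apply/seteqP; split=> [[u v] uvN|_ [a _ <-] y z]; last first.
  by rewrite /associator !unitalE subrr.
have v0 : v = 0.
  apply: annihilator_commutators => x y.
  have := congr1 snd (uvN (x, 0) (bar y, 0)); rewrite /associator /= !zeroE.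
  by rewrite ?(bar_antimul bar_can) ?(bar_involutive bar_can) -!mulrA mulrBr.
apply: scalars_of_components => // w.
have := congr1 snd (uvN (w, 0) (0, 1)); rewrite /associator v0 /= !zeroE.
by rewrite !mul1r => /eqP; rewrite subr_eq0 => /eqP.
Qed.

Lemma Nuc_r_doubling : Nuc_r doubling = scalars D.
Proof.
apply/seteqP; split=> [[u v] uvN|_ [a _ <-] y z]; last first.
  by rewrite /associator !unitalE subrr.
have v0 : v = 0.
  apply: annihilator_commutators => x y.
  have := congr1 snd (uvN (x, 0) (y, 0)); rewrite /associator /= !zeroE.
  by rewrite -!mulrA mulrBr.
apply: scalars_of_components => // w.
(* In the third position [u] appears conjugated, so the identity obtained is
   [bar (u * w) = bar (w * u)] up to symmetry, and [bar] is injective. *)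
have := congr1 snd (uvN (bar w, 0) (0, 1)); rewrite /associator v0 /= !zeroE.
rewrite !mul1r -!(bar_antimul bar_can) => /eqP.
by rewrite subr_eq0 => /eqP/(can_inj (bar_involutive bar_can)).
Qed.

Lemma Comm_doubling : Comm doubling = scalars D.
Proof.
apply/seteqP; split=> [[u v] uvC|_ [a _ <-] y]; last by rewrite !unitalE.
have v0 : v = 0.
  apply: annihilator_bar_sub => w.
  have := congr1 snd (uvC (w, 0)); rewrite /= !mul0r add0r addr0 => vw.
  by rewrite mulrBr vw subrr.
apply: scalars_of_components => // w.
by have := congr1 fst (uvC (w, 0)); rewrite /= P0l P0r !addr0.
Qed.

Lemma Nuc_doubling : Nuc doubling = scalars D.
Proof.
by rewrite /Nuc Nuc_l_doubling Nuc_m_doubling Nuc_r_doubling !setIid.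
Qed.

Lemma Center_doubling : Center doubling = scalars D.
Proof. by rewrite /Center Nuc_doubling Comm_doubling setIid. Qed.

End Doubling.

End QuaternionAlgebra.

Theorem lemma7 (F : fieldType) (D : falgType F) (bar : D -> D) (c : D)
    (D_quat : quaternion_algebra D) (bar_can : canonical_involution bar)
    (c_unit : c \is a GRing.unit) (c_notin_F : c \notin 1%VS) :
  [/\ (let A := Cay bar c in
       [/\ Nuc_l A = scalars D, Nuc_m A = scalars D & Nuc_r A = scalars D] /\
       [/\ Nuc A = scalars D, Comm A = scalars D & Center A = scalars D]),
      (let A := Cay_m bar c in
       let S := [set x : D * D | x.1 \in 1%VS /\
                  forall u' v' : D, x.2 * (bar u' - u') = 0 /\
                    bar v' * c * x.2 = bar x.2 * c * v'] in
       let T := [set x : D * D | [/\ x.1 \in 1%VS, c * x.2 = bar x.2 * c &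
                                     qnorm bar x.2 = 0]] in
       [/\ Nuc_l A = scalars D, Nuc_m A = scalars D & Nuc_r A = scalars D] /\
       [/\ Nuc A = scalars D,
           division_algebra D -> Comm A = scalars D,
           ~ division_algebra D -> Comm A = S /\ S `<=` T &
           Center A = scalars D]) &
      (let A := Cay_r bar c in
       [/\ Nuc_l A = scalars D, Nuc_m A = scalars D & Nuc_r A = scalars D] /\
       [/\ Nuc A = scalars D, Comm A = scalars D & Center A = scalars D])].
Proof.
have ncD : exists x y : D, x * y != y * x.
  have /subvPn[y _] : ~~ ({:D} <= 'C[c])%VS.
    apply: contra c_notin_F => /subvP cD; apply/vlineP.
    apply: (quaternion_central_scalar D_quat) => y.
    exact/esym/cent1vP/cD/memvf.
  by move=> yc; exists y, c; apply: contra yc => /eqP/cent1vP.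
have doubledP (P : D -> D -> D)
    (Pl : forall (a : F) x y, P (a *: x) y = a *: P x y)
    (Pr : forall (a : F) x y, P x (a *: y) = a *: P x y) :
    let A := doubling bar P in
    [/\ Nuc_l A = scalars D, Nuc_m A = scalars D & Nuc_r A = scalars D] /\
    [/\ Nuc A = scalars D, Comm A = scalars D & Center A = scalars D].
  split; split.
  - exact: Nuc_l_doubling.
  - exact: Nuc_m_doubling.
  - exact: Nuc_r_doubling.
  - exact: Nuc_doubling.
  - exact: Comm_doubling.
  - exact: Center_doubling.
have barZ := barZ bar_can.
split.
(* [Cay] is convertible to [doubling] for this [P], so only homogeneity remains to be checked. *)
- apply: (doubledP (fun v' v => c * bar v' * v)) => a x y.
    by rewrite barZ -scalerAr -scalerAl.
  by rewrite -scalerAr.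
- have [a x y|a x y|Nucs [NucF CommF CenterF]] :=
    doubledP (fun v' v => bar v' * c * v).
  + by rewrite barZ -!scalerAl.
  + by rewrite -scalerAr.
  move=> A S T; split; first exact: Nucs.
  (* The condition [v * (bar u' - u') = 0] forces [v = 0], so [S] is F itself. Hence [CommF] yields
     the description by [S], and [S] lies in [T] because scalars do. *)
  have S_scalars : S = scalars D.
    apply/seteqP; split=> [[u v] [/= /vlineP[a ->] vS]|_ [a _ <-]].
      have -> : v = 0.
        by apply: (annihilator_bar_sub D_quat ncD bar_can) => w; case: (vS w 0).
      by exists a => //; congr pair; rewrite /= scaler0.
    split=> [|u' v'] /=; first exact/vlineP/(ex_intro _ a).
    by rewrite scaler0 (bar0 bar_can) mul0r mulr0 !mul0r.
  split=> // _; split; first by rewrite S_scalars.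
  rewrite S_scalars => _ [a _ <-]; split=> /=; first exact/vlineP/(ex_intro _ a).
    by rewrite scaler0 (bar0 bar_can) mulr0 mul0r.
  by rewrite scaler0 /qnorm mul0r.
- apply: (doubledP (fun v' v => bar v' * v * c)) => a x y.
    by rewrite barZ -!scalerAl.
  by rewrite -scalerAr -scalerAl.
Qed.
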